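(* The Banach space $X_{iw}$ has the Lebesgue property.
   Context: Lebesgue property. A function $f:[0,1]\to X$ into a Banach space $X$ is Riemann-integrable if there is $x_f\in X$ such that for every $\varepsilon>0$ there is $\delta>0$ with $\|x_f-\sum_{i=1}^d(p_i-p_{i-1})f(t_i)\|<\varepsilon$ for every partition $0=p_0<p_1<\dots<p_d=1$ with $\max_i(p_i-p_{i-1})<\delta$ and every choice of tags $t_i\in[p_{i-1},p_i]$. $X$ has the Lebesgue property if every Riemann-integrable function $f:[0,1]\to X$ is continuous at Lebesgue almost every point of $[0,1]$. The space $X_{iw}$ (Argyros–Motakis). Let $c_{00}$ be the space of finitely supported real sequences indexed by $\mathbb{N}=\{1,2,\dots\}$, with unit vectors $e_i$; elements of $c_{00}$ also act as functionals on $c_{00}$ by $f(x)=\sum_i f_ix_i$, and $e_i^*$ denotes the $i$-th unit vector viewed as a functional. For vectors or functionals (respectively finite sets), $x<y$ means $\max\operatorname{supp}(x)<\min\operatorname{supp}(y)$ (respectively $\max E<\min F$). Schreier families: $S_0=\{\{i\}:i\in\mathbb{N}\}$, $S_1=\{F\subset\mathbb{N}: |F|\le\min F\}$, and inductively $S_{n+1}=\{F\subset\mathbb{N}: F=\bigcup_{i=1}^dF_i,\ F_1<\dots<F_d,\ F_i\in S_n,\ d\le\min F_1\}$. A sequence $x_1<\dots<x_r$ in $c_{00}$ is $S_n$-admissible if $\{\min\operatorname{supp}(x_i):1\le i\le r\}\in S_n$. Fix a strictly increasing sequence $(a_k)_{k\ge1}$ of positive integers with $a_1=2$ and a strictly increasing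 sequence $(b_k)_{k\ge1}$ of positive integers with $b_1=1$ and $b_{k+1}>b_k\log(a_{k+1}^2)$ for all $k$. Weighted functionals of a set $G\subset c_{00}$: if $k_1,\dots,k_l$ are positive integers, $f_1<\dots<f_r$ are functionals belonging to $G$ that are $S_{b_{k_1}+\dots+b_{k_l}}$-admissible, and $f=\frac{1}{a_{k_1}\cdots a_{k_l}}\sum_{q=1}^rf_q$ belongs to $G$, then $f$ is said to have weight $w(f)=a_{k_1}\cdots a_{k_l}$. The functionals $\pm e_i^*$ are defined to have infinite weight. A sequence $f_1<f_2<\cdots$ of weighted functionals in $G$ is very fast growing if $\max\operatorname{supp}(f_{q-1})<w(f_q)$ for all $q>1$. Norming set: with these notions taken for $G=W_{iw}$, the set $W_{iw}$ is the smallest subset of $c_{00}$ such that $\pm e_i^*\in W_{iw}$ for all $i$, and such that $\frac{1}{a_{k_1}\cdots a_{k_l}}\sum_{q=1}^rf_q\in W_{iw}$ whenever $k_1,\dots,k_l$ are positive integers and $f_1<\dots<f_r$ are weighted functionals in $W_{iw}$ that are $S_{b_{k_1}+\dots+b_{k_l}}$-admissible and very fast growing. $X_{iw}$ is the completion of $c_{00}$ under the norm $\|x\|=\sup\{f(x):f\in W_{iw}\}$. *)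

(* Defs.v *)
From mathcomp Require Export all_boot all_order all_algebra finmap.
From mathcomp Require Export all_classical all_reals all_analysis.
Export Order.TTheory GRing.Theory Num.Theory.
Export numFieldNormedType.Exports.

Set Implicit Arguments.
Unset Strict Implicit.
Unset Printing Implicit Defensive.

Local Open Scope classical_set_scope.
Local Open Scope ring_scope.

(* A function on [0,1] is given by
   f : R -> X; its values outside [0,1] are never used. *)
Section LebesgueProperty.
Context {R : realType} (X : completeNormedModType R).

Definition riemann_integrable (f : R -> X) : Prop :=
  exists xf : X, forall eps : R, 0 < eps ->
    exists2 delta : R, 0 < delta &
      forall (d : nat) (p t : nat -> R),
        p 0%N = 0 -> p d = 1 ->
        (forall i, (i < d)%N -> p i < p i.+1) ->
        (forall i, (i < d)%N -> p i.+1 - p i < delta) ->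
        (forall i, (i < d)%N -> p i <= t i <= p i.+1) ->
        `|xf - \sum_(i < d) (p i.+1 - p i) *: f (t i)| < eps.

Definition lebesgue_property : Prop :=
  forall f : R -> X, riemann_integrable f ->
    {ae @lebesgue_measure R, forall x : R,
      x \in `[0, 1] -> f @ within `[0, 1]%classic (nbhs x) --> f x}.

End LebesgueProperty.

(* Finite subsets of {1, 2, ...}.  The index 0 : nat is unused throughout. *)

(* Both are 0 on the empty set. *)
Definition fsmax (F : {fset nat}) : nat := (\max_(i <- F) i)%N.
Definition fsmin (F : {fset nat}) : nat := head 0%N (sort leq F).

(* Members are nonempty sets of positive integers.  The empty set, which has no
   minimum, is left out of every family: allowing it as a piece would make the
   bound d <= min F_1 meaningless. *)
Fixpoint schreier (n : nat) (F : {fset nat}) : Prop :=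
  match n with
  | 0%N => exists2 i : nat, (0 < i)%N & F = [fset i]%fset
  | n'.+1 =>
    match n' with
    | 0%N => F <> fset0 /\ (#|` F| <= fsmin F)%N
    | _.+1 => exists (d : nat) (E : nat -> {fset nat}),
      [/\ (0 < d)%N,
          forall x : nat, x \in F <-> exists2 i, (i < d)%N & x \in E i,
          forall i, (i.+1 < d)%N -> (fsmax (E i) < fsmin (E i.+1))%N,
          forall i, (i < d)%N -> schreier n' (E i)
        & (d <= fsmin (E 0))%N]
    end
  end.

Section Xiw.
Context {R : realType}.
Implicit Types (x f g : nat -> R) (a b : nat -> nat) (G : set (nat -> R)).

Definition c00 : set (nat -> R) :=
  [set x | x 0%N = 0 /\ finite_set [set i | x i != 0]].

Definition unit_vec (i : nat) : nat -> R := fun j => (i == j)%:R.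

Definition pairing f x : R := \sum_(i \in [set: nat]) f i * x i.

Definition supp x : {fset nat} := fset_set [set i | x i != 0].

(* f 0 < ... < f r.-1, with r > 0 and all supports nonempty *)
Definition block_seq (r : nat) (f : nat -> nat -> R) : Prop :=
  [/\ (0 < r)%N,
      forall q, (q < r)%N -> c00 (f q) /\ supp (f q) <> fset0
    & forall q, (q.+1 < r)%N -> (fsmax (supp (f q)) < fsmin (supp (f q.+1)))%N].

Definition admissible (n r : nat) (f : nat -> nat -> R) : Prop :=
  schreier n [fset q in [seq fsmin (supp (f q)) | q <- iota 0 r]]%fset.

(* The list ks = [k_1; ...; k_l] of positive integers determines the weight
   a_{k_1} ... a_{k_l} and the Schreier index b_{k_1} + ... + b_{k_l}. *)
Definition pos_list (ks : seq nat) : Prop := ks != [::] /\ all (leq 1) ks.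
Definition weight a (ks : seq nat) : nat := (\prod_(k <- ks) a k)%N.
Definition schreier_order b (ks : seq nat) : nat := (\sum_(k <- ks) b k)%N.

Definition average a (ks : seq nat) (r : nat) (f : nat -> nat -> R) : nat -> R :=
  ((weight a ks)%:R)^-1 *: \sum_(q < r) f q.

(* The weight of f in G need not be unique, so it is a relation; None is the
   infinite weight. *)
Definition has_weight a b G f (w : option nat) : Prop :=
  if w is Some m then
    G f /\ exists (ks : seq nat) (r : nat) (h : nat -> nat -> R),
      [/\ pos_list ks,
          block_seq r h /\ (forall q, (q < r)%N -> G (h q)),
          admissible (schreier_order b ks) r h,
          f = average a ks r h
        & m = weight a ks]
  else exists2 i : nat, (0 < i)%N & f = unit_vec i \/ f = - unit_vec i.

Definition lt_weight (n : nat) (w : option nat) : Prop :=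
  if w is Some m then (n < m)%N else True.

Definition very_fast_growing a b G (r : nat) (f : nat -> nat -> R) : Prop :=
  exists w : nat -> option nat,
    (forall q, (q < r)%N -> has_weight a b G (f q) (w q)) /\
    (forall q, (q.+1 < r)%N -> lt_weight (fsmax (supp (f q))) (w q.+1)).

Definition norming_closed a b G : Prop :=
  [/\ G `<=` c00,
      forall i : nat, (0 < i)%N -> G (unit_vec i) /\ G (- unit_vec i)
    & forall (ks : seq nat) (r : nat) (f : nat -> nat -> R),
        pos_list ks ->
        block_seq r f ->
        (forall q, (q < r)%N -> G (f q)) ->
        admissible (schreier_order b ks) r f ->
        very_fast_growing a b G r f ->
        G (average a ks r f)].

Definition W_iw a b : set (nat -> R) := smallest (norming_closed a b) set0.

Definition norm_iw a b x : R := sup [set pairing f x | f in W_iw a b].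

(* (X, j) is a completion of c00 under norm_iw; this determines X up to
   isometric isomorphism.  The values of j outside c00 are irrelevant. *)
Definition is_X_iw a b (X : completeNormedModType R) (j : (nat -> R) -> X) : Prop :=
  [/\ forall (c : R) x y, c00 x -> c00 y -> j (c *: x + y) = c *: j x + j y,
      forall x, c00 x -> `|j x| = norm_iw a b x
    & dense (j @` c00)].

End Xiw.

(* Main.v *)
Require Import Defs.
From mathcomp Require Import zify ring lra.

(* Suppose [f] is discontinuous on a set of positive measure.  Real-valued
   Riemann-integrable functions are almost everywhere continuous, hence at almost
   every such point [x] the coordinates of [f] are continuous and there are [s]
   arbitrarily close to [x] such that [f s - f x] is, up to a small error, a vector
   [z] of norm bounded below whose support lies arbitrarily far out.  Such a [z] is
   almost normed by an average [(h_1 + ... + h_r) / w] in the norming set.  Deleting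
   the pieces up to the first one reaching the support of [z] costs at most half of
   the norm, because [w >= 2], and very fast growth makes the weights of the
   remaining pieces exceed anything chosen before [z].

   Either [w] can be taken arbitrarily large at [x], or a single list
   [k_1, ..., k_l] defining the weight occurs for [z] arbitrarily far out.  There are
   countably many such alternatives, so one of them holds on a non-negligible set.
   For points [x_1, ..., x_m] of that set, one chooses [z_1, ..., z_m] successively;
   in the first case the truncated averages themselves, in the second one all of
   their pieces together, form a very fast growing sequence, which is S_1-admissible,
   respectively S_(b_(k_1) + ... + b_(k_l) + 1)-admissible.  As [a_1 = 2] and
   [b_1 = 1], half of the sum of the truncated averages lies in the norming set, so
   the norm of [z_1 + ... + z_m] is at least proportional to [m].  With one point in each
   of the intervals of a fine uniform partition that meet the set, this
   contradicts the Riemann integrability of [f].  The same argument applied to the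
   coordinate functionals gives their almost everywhere continuity. *)

Set Implicit Arguments.
Unset Strict Implicit.
Unset Printing Implicit Defensive.

Local Open Scope classical_set_scope.
Local Open Scope ring_scope.

(** * Schreier families *)

Lemma leq_fsmax (F : {fset nat}) x : x \in F -> (x <= fsmax F)%N.
Proof. by move=> xF; rewrite /fsmax (big_rem x)//= leq_maxl. Qed.

Lemma fsmax_leq (F : {fset nat}) n :
  (forall x, x \in F -> (x <= n)%N) -> (fsmax F <= n)%N.
Proof. by move=> Fn; apply/bigmax_leqP_seq => x xF _; exact: Fn. Qed.

Lemma fsmin_in (F : {fset nat}) : F <> fset0 -> fsmin F \in F.
Proof.
move=> F0; rewrite /fsmin -(mem_sort leq).
case E : (sort leq F) => [|x s] /=; last by rewrite mem_head.
exfalso; apply: F0; apply/fsetP => x.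
by rewrite -(mem_sort leq) E inE.
Qed.

Lemma fsmin_leq (F : {fset nat}) x : x \in F -> (fsmin F <= x)%N.
Proof.
rewrite /fsmin -(mem_sort leq) => xF.
have := sort_sorted leq_total F.
case: (sort leq F) xF => //= y s; rewrite inE => /orP[/eqP-> //|xs].
by rewrite (path_sortedE leq_trans) => /andP[/allP/(_ _ xs)].
Qed.

Lemma fset_neq0 (F : {fset nat}) x : x \in F -> F <> fset0.
Proof. by move=> + F0; rewrite F0 inE. Qed.

Lemma fset_neq0P (F : {fset nat}) : F <> fset0 -> exists x, x \in F.
Proof. by move=> /fsmin_in F0; exists (fsmin F). Qed.

Lemma leq_fsmin (F : {fset nat}) n : F <> fset0 ->
  (forall x, x \in F -> (n <= x)%N) -> (n <= fsmin F)%N.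
Proof. by move=> /fsmin_in F0; apply. Qed.

Lemma fsmin_le_max (F : {fset nat}) : F <> fset0 -> (fsmin F <= fsmax F)%N.
Proof. by move=> /fsmin_in; exact: leq_fsmax. Qed.

Lemma fset1_neq0 (i : nat) : [fset i]%fset <> fset0 :> {fset nat}.
Proof. by apply: (@fset_neq0 _ i); rewrite inE. Qed.

Lemma fsmin1 i : fsmin [fset i]%fset = i.
Proof. by have := fsmin_in (@fset1_neq0 i); rewrite inE => /eqP. Qed.

Lemma schreierSS n F : schreier n.+2 F =
  exists (d : nat) (E : nat -> {fset nat}),
      [/\ (0 < d)%N,
          forall x : nat, x \in F <-> exists2 i, (i < d)%N & x \in E i,
          forall i, (i.+1 < d)%N -> (fsmax (E i) < fsmin (E i.+1))%N,
          forall i, (i < d)%N -> schreier n.+1 (E i)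
        & (d <= fsmin (E 0))%N].
Proof. by []. Qed.

Lemma schreier_neq0 n F : schreier n F -> F <> fset0.
Proof.
elim: n F => [F [i _ ->]|[|n] IH F]; [exact: fset1_neq0|by case|].
rewrite schreierSS => -[d [E [d0 FE _ Es _]]].
have [x xE] := fset_neq0P (IH _ (Es _ d0)).
by apply: (@fset_neq0 _ x); apply/FE; exists 0%N.
Qed.

Lemma fsmin_chain d (E : nat -> {fset nat}) :
  (forall i, (i < d)%N -> E i <> fset0) ->
  (forall i, (i.+1 < d)%N -> (fsmax (E i) < fsmin (E i.+1))%N) ->
  forall i k, (i < k)%N -> (k < d)%N -> (fsmax (E i) < fsmin (E k))%N.
Proof.
move=> E0 Ec i; elim=> // k IH; rewrite ltnS leq_eqVlt => /orP[/eqP <-|ik kd].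
  exact: Ec.
have kd' : (k < d)%N by exact: ltnW.
exact: (ltn_trans (IH ik kd') (leq_ltn_trans (fsmin_le_max (E0 _ kd')) (Ec _ kd))).
Qed.

(* Only final segments are kept, so that the pieces met by the segment are
   consecutive. *)
Lemma schreier_tail n p F F' : schreier n F -> F' <> fset0 ->
  (forall x, (x \in F') = (x \in F) && (p <= x)%N) -> schreier n F'.
Proof.
elim: n F F' => [F F' [i i0 ->] F'0 F'E|[|n] IH F F' sF F'0 F'E].
- exists i => //; apply/fsetP => x; have [y yF'] := fset_neq0P F'0.
  have: (y \in F') by []. rewrite F'E !inE => /andP[/eqP yi pi].
  by rewrite F'E !inE; case: eqP => //= ->; rewrite -yi.
- case: sF => F0 Fm; split => //.
  have sub : (F' `<=` F)%fset by apply/fsubsetP => x; rewrite F'E => /andP[].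
  rewrite (leq_trans (fsubset_leq_card sub))// (leq_trans Fm)//.
  by apply: leq_fsmin => // x xF'; apply: fsmin_leq; exact: (fsubsetP sub).
- move: sF; rewrite !schreierSS => -[d [E [d0 FE Ec Es dE]]].
  have E0 i : (i < d)%N -> E i <> fset0 by move=> /Es /schreier_neq0.
  (* The first index satisfying [P] is the first piece reaching [p]: earlier pieces disappear, this
     one may be cut, and all later ones survive whole because they lie beyond its maximum. *)
  pose P i := (i < d)%N && (p <= fsmax (E i))%N.
  have exP : exists i, P i.
    have [x] := fset_neq0P F'0; rewrite F'E => /andP[/FE[i id xE] px].
    by exists i; rewrite /P id (leq_trans px)//; exact: leq_fsmax.
  case: (ex_minnP exP) => i0 /andP[i0d pi0] i0min.
  pose E' k := [fset x in E (i0 + k)%N | (p <= x)%N]%fset.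
  have mE' k x : (x \in E' k) = (x \in E (i0 + k)%N) && (p <= x)%N by rewrite !inE.
  have chain := fsmin_chain E0 Ec.
  have E'0 k : (i0 + k < d)%N -> E' k <> fset0.
    move=> kd; have [x xE] : exists2 x, x \in E (i0 + k)%N & (p <= x)%N.
      case: k kd => [|k] kd; last first.
        exists (fsmin (E (i0 + k.+1)%N)); first exact/fsmin_in/E0.
        by rewrite (leq_trans pi0)// ltnW// chain// addnS ltnS leq_addr.
      rewrite addn0; apply: contrapT => h; move: pi0; apply/negP; rewrite -ltnNge.
      have pp : (0 < p)%N.
        case: (p) h => // h; exfalso; apply: h.
        by have [x xE] := fset_neq0P (E0 _ i0d); exists x.
      rewrite -(prednK pp) ltnS; apply: fsmax_leq => x xE.
      rewrite -ltnS prednK// ltnNge; apply/negP => px; apply: h; by exists x.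
    by move=> px; apply: (@fset_neq0 _ x); rewrite mE' xE.
  exists (d - i0)%N, E'; split.
  + by rewrite subn_gt0.
  + move=> x; rewrite F'E; split.
      move=> /andP[/FE[i id xE] px].
      have i0i : (i0 <= i)%N.
        by apply: i0min; rewrite /P id (leq_trans px)//; exact: leq_fsmax.
      by exists (i - i0)%N; [lia|rewrite mE' subnKC// xE].
    move=> [i id]; rewrite mE' => /andP[xE ->]; rewrite andbT.
    by apply/FE; exists (i0 + i)%N => //; lia.
  + move=> i id.
    apply: (@leq_ltn_trans (fsmax (E (i0 + i)%N))).
      by apply: fsmax_leq => x; rewrite mE' => /andP[xE _]; exact: leq_fsmax.
    apply: (@leq_trans (fsmin (E (i0 + i.+1)%N))).
      by rewrite addnS Ec//; lia.
    apply: leq_fsmin; first by apply: E'0; lia.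
    by move=> x; rewrite mE' => /andP[xE _]; exact: fsmin_leq.
  + move=> i id; apply: (IH (E (i0 + i)%N)); first by apply: Es; lia.
      by apply: E'0; lia.
    by move=> x; exact: mE'.
  (* Discarding pieces does not increase their number and does not lower the minimum of the first
     one. *)
  + rewrite (leq_trans (leq_subr _ _))// (leq_trans dE)//.
    apply: leq_fsmin; first by apply: E'0; lia.
    move=> x; rewrite mE' addn0 => /andP[xE _].
    apply: (leq_trans _ (fsmin_leq xE)).
    case: (posnP i0) => [->//|i00].
    exact: (leq_trans (fsmin_le_max (E0 _ d0)) (ltnW (chain _ _ i00 i0d))).
Qed.

(** The definition treats order 1 separately, through cardinality. This is an introduction rule
    uniform in the order: from order 0 to order 1, a union of [d] singletons has at most [d]
    elements. *)
Lemma schreierS n F d (E : nat -> {fset nat}) :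
  (0 < d)%N ->
  (forall x : nat, x \in F <-> exists2 i, (i < d)%N & x \in E i) ->
  (forall i, (i.+1 < d)%N -> (fsmax (E i) < fsmin (E i.+1))%N) ->
  (forall i, (i < d)%N -> schreier n (E i)) ->
  (d <= fsmin (E 0))%N -> schreier n.+1 F.
Proof.
case: n => [|n] d0 FE Ec Es dE; last by rewrite schreierSS; exists d, E; split.
have E0 i : (i < d)%N -> E i <> fset0 by move=> /Es /schreier_neq0.
have F0 : F <> fset0.
  have [x xE] := fset_neq0P (E0 _ d0).
  by apply: (@fset_neq0 _ x); apply/FE; exists 0%N.
split => //; apply: (@leq_trans d).
  have sub : {subset F <= [seq fsmin (E i) | i <- iota 0 d]}.
    move=> x /FE[i id]; have [k _ Ek] := Es _ id; rewrite Ek inE => /eqP ->.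
    by apply/mapP; exists i; rewrite ?mem_iota// Ek fsmin1.
  by have := uniq_leq_size (fset_uniq F) sub; rewrite size_map size_iota.
apply: (leq_trans dE); apply: leq_fsmin => // x /FE[i id xE].
case: (posnP i) => [i0|i0]; first by rewrite i0 in xE; exact: fsmin_leq.
apply: leq_trans (fsmin_leq xE).
exact: (leq_trans (fsmin_le_max (E0 _ d0)) (ltnW (fsmin_chain E0 Ec i0 id))).
Qed.

(** * Finitely supported vectors *)

Section FiniteVectors.
Context {R : realType}.
Implicit Types (x y f : nat -> R).

Lemma c00P x : c00 x <-> x 0%N = 0 /\ exists n, forall i, (n <= i)%N -> x i = 0.
Proof.
split=> -[x0].
  move=> fx; split => //; exists (fsmax (supp x)).+1 => i.
  apply: contraTeq => xi; rewrite -ltnNge ltnS; apply: leq_fsmax.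
  by rewrite in_fset_set// inE.
move=> [n xn]; split => //; apply: sub_finite_set (finite_II n) => i /=.
by apply: contraNltn => /xn ->.
Qed.

Lemma in_supp x i : c00 x -> (i \in supp x) = (x i != 0).
Proof. by move=> [_ fx]; rewrite /supp in_fset_set//; apply/idP/idP; rewrite inE. Qed.

Lemma supp_neq0 x i : c00 x -> x i != 0 -> supp x <> fset0.
Proof. by move=> cx xi; apply: (@fset_neq0 _ i); rewrite in_supp. Qed.

Lemma c00_0 : c00 (0 : nat -> R).
Proof. by apply/c00P; split => //; exists 0%N. Qed.

Lemma c00_lin (c : R) x y : c00 x -> c00 y -> c00 (c *: x + y).
Proof.
move=> /c00P[x0 [n xn]] /c00P[y0 [m ym]]; apply/c00P.
have E i : (c *: x + y) i = c * x i + y i by [].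
split; first by rewrite E x0 y0 mulr0 addr0.
by exists (maxn n m) => i; rewrite geq_max => /andP[/xn + /ym +]; rewrite E => -> ->;
  rewrite mulr0 addr0.
Qed.

Lemma c00D x y : c00 x -> c00 y -> c00 (x + y).
Proof. by move=> cx cy; rewrite -[x]scale1r; exact: c00_lin. Qed.

Lemma c00Z (c : R) x : c00 x -> c00 (c *: x).
Proof. by move=> cx; rewrite -[_ *: _]addr0; exact: c00_lin cx c00_0. Qed.

Lemma c00_sum (I : eqType) (s : seq I) (F : I -> nat -> R) :
  (forall i, i \in s -> c00 (F i)) -> c00 (\sum_(i <- s) F i).
Proof.
move=> cF; rewrite big_seq; elim/big_ind: _ => //; [exact: c00_0|exact: c00D].
Qed.

Lemma c00_unit i : (0 < i)%N -> c00 (unit_vec i : nat -> R).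
Proof.
move=> i0; apply/c00P; split; first by rewrite /unit_vec gtn_eqF.
by exists i.+1 => k ik; rewrite /unit_vec ltn_eqF.
Qed.

Lemma pairingE f x n : (forall i, (n <= i)%N -> f i * x i = 0) ->
  pairing f x = \sum_(i < n) f i * x i.
Proof.
move=> h; rewrite (fsbig_ord _ n (fun i => f i * x i)); symmetry.
by apply: fsbig_widen => // i [_ /=] /negP; rewrite -leqNgt => /h.
Qed.

Lemma pairing_vecE f x n : (forall i, (n <= i)%N -> x i = 0) ->
  pairing f x = \sum_(i < n) f i * x i.
Proof. by move=> h; apply: pairingE => i /h ->; rewrite mulr0. Qed.

Lemma pairing_linl (c : R) f g x : c00 x ->
  pairing (c *: f + g) x = c * pairing f x + pairing g x.
Proof.
move=> /c00P[_ [n xn]]; rewrite !(pairing_vecE _ xn) mulr_sumr -big_split /=.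
by apply: eq_bigr => i _; rewrite !fctE mulrDl -mulrA.
Qed.

Lemma pairing_linr (c : R) f x y : c00 x -> c00 y ->
  pairing f (c *: x + y) = c * pairing f x + pairing f y.
Proof.
move=> /c00P[_ [n xn]] /c00P[_ [m ym]].
have xE i : (maxn n m <= i)%N -> x i = 0 by rewrite geq_max => /andP[/xn].
have yE i : (maxn n m <= i)%N -> y i = 0 by rewrite geq_max => /andP[_ /ym].
rewrite (pairing_vecE _ xE) (pairing_vecE _ yE) (@pairing_vecE _ _ (maxn n m)).
  rewrite mulr_sumr -big_split /=; apply: eq_bigr => i _.
  by rewrite !fctE mulrDr mulrCA.
by move=> i im; rewrite !fctE xE// yE// scaler0 addr0.
Qed.

Lemma pairing0l x : pairing 0 x = 0.
Proof.
rewrite (@pairingE _ _ 0) ?big_ord0// => i _.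
by rewrite /GRing.zero /= mul0r.
Qed.

Lemma pairingZl (c : R) f x : c00 x -> pairing (c *: f) x = c * pairing f x.
Proof. by move=> cx; rewrite -[_ *: _]addr0 pairing_linl// pairing0l addr0. Qed.

Lemma pairingDl f g x : c00 x -> pairing (f + g) x = pairing f x + pairing g x.
Proof. by move=> cx; rewrite -[f]scale1r pairing_linl// mul1r scale1r. Qed.

Lemma pairingDr f x y : c00 x -> c00 y ->
  pairing f (x + y) = pairing f x + pairing f y.
Proof. by move=> cx cy; rewrite -[x]scale1r pairing_linr// mul1r scale1r. Qed.

Lemma pairing_suml (I : Type) (s : seq I) (F : I -> nat -> R) x : c00 x ->
  pairing (\sum_(i <- s) F i) x = \sum_(i <- s) pairing (F i) x.
Proof.
move=> cx; elim: s => [|i s IH]; first by rewrite !big_nil pairing0l.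
by rewrite !big_cons pairingDl// IH.
Qed.

Lemma pairing_disj f x : (forall i, f i != 0 -> x i = 0) -> pairing f x = 0.
Proof.
move=> h; rewrite (@pairingE _ _ 0) ?big_ord0// => i _.
by have [->|/h ->] := eqVneq (f i) 0; rewrite ?mul0r ?mulr0.
Qed.

Lemma pairing_unit i x : c00 x -> pairing (unit_vec i) x = x i.
Proof.
move=> /c00P[_ [n xn]].
have xE k : (maxn n i.+1 <= k)%N -> x k = 0 by rewrite geq_max => /andP[/xn].
rewrite (pairing_vecE _ xE).
have im : (i < maxn n i.+1)%N by rewrite leq_max ltnSn orbT.
rewrite (bigD1 (Ordinal im))//= big1; first by rewrite /unit_vec eqxx mul1r addr0.
move=> k; rewrite -val_eqE /= => ki.
by rewrite /unit_vec eq_sym (negbTE ki) mul0r.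
Qed.

Lemma fsmin_supp x : c00 x -> supp x <> fset0 -> x (fsmin (supp x)) != 0.
Proof. by move=> cx /fsmin_in; rewrite in_supp. Qed.

Lemma suppP x i : c00 x -> x i != 0 -> (fsmin (supp x) <= i <= fsmax (supp x))%N.
Proof. by move=> cx xi; rewrite fsmin_leq ?leq_fsmax// in_supp. Qed.

End FiniteVectors.

(** * The norming set *)

Section NormingSet.
Context {R : realType} (a b : nat -> nat).
Context (a_ge2 : forall k, (0 < k)%N -> (1 < a k)%N).

Local Notation vec := (nat -> R).
Local Notation W := (@W_iw R a b).
Implicit Types (x z f : vec) (ks : seq nat).

Lemma weight_gt1 ks : pos_list ks -> (1 < weight a ks)%N.
Proof.
case: ks => [[]//|k ks [_ /= /andP[k0 kp]]]; rewrite /weight big_cons.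
have : (0 < \prod_(i <- ks) a i)%N.
  rewrite big_seq; apply: prodn_cond_gt0 => i /(allP kp) /a_ge2; exact: ltnW.
by have := a_ge2 k0; nia.
Qed.

Lemma block_lt r (h : nat -> vec) i k : block_seq r h -> (i < k)%N -> (k < r)%N ->
  (fsmax (supp (h i)) < fsmin (supp (h k)))%N.
Proof.
move=> [r0 hc hm]; apply: (@fsmin_chain r (fun i => supp (h i))) => // q qr.
by case: (hc _ qr).
Qed.

Lemma block_sum_at r (h : nat -> vec) q i : block_seq r h -> (q < r)%N ->
  h q i != 0 -> (\sum_(k < r) h k) i = h q i.
Proof.
move=> bh qr hq; rewrite fct_sumE (bigD1 (Ordinal qr))//= big1 ?addr0// => k.
rewrite -val_eqE /= neq_ltn => kq; apply: contra_neq_eq hq => hk; apply: contrapT => /eqP hq.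
have [_ hc _] := bh.
have kr := ltn_ord k.
have := suppP (hc _ kr).1 hk; have := suppP (hc _ qr).1 hq.
by case/orP: kq => kq; have := block_lt bh kq; lia.
Qed.

(** [W_iw] is an intersection of closed sets, so a property of its members is proved by exhibiting a
    closed set. Supports of a block sequence are disjoint, hence each coordinate of an average comes
    from at most one piece, divided by the weight. *)
Lemma norming_closed_bounded :
  norming_closed a b [set f : vec | [/\ c00 f, supp f <> fset0 & forall i, `|f i| <= 1]].
Proof.
split.
- by move=> f [].
- have aux (f : vec) i : (0 < i)%N -> c00 f -> (forall k, `|f k| = `|unit_vec i k : R|) ->
      [set f | [/\ c00 f, supp f <> fset0 & forall i, `|f i| <= 1]] f.
    move=> i0 cf fE; split => //.
      by apply: (supp_neq0 (i := i)) => //; rewrite -normr_eq0 fE /unit_vec eqxx normr1 oner_eq0.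
    by move=> k; rewrite fE /unit_vec; case: eqP; rewrite ?normr1 ?normr0.
  move=> i i0; split; apply: (aux _ i) => //; first exact: c00_unit.
    by rewrite -scaleN1r; apply/c00Z/c00_unit.
  by move=> k; rewrite opprfctE normrN.
- move=> ks r h pks bh hG _ _.
  have [r0 hc _] := bh.
  have w1 := weight_gt1 pks.
  have w0 : (0 < (weight a ks)%:R :> R) by rewrite ltr0n ltnW.
  have aE i : average a ks r h i = ((weight a ks)%:R)^-1 * (\sum_(k < r) h k) i by [].
  have cA : c00 (average a ks r h).
    by apply: c00Z; apply: c00_sum => i _; case: (hc _ (ltn_ord i)).
  split=> //.
    (* The leading coordinate of the first piece meets no other piece, so it cannot cancel. *)
    have [c0 s0] := hc _ r0.
    have h0 := fsmin_supp c0 s0.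
    apply: (supp_neq0 (i := fsmin (supp (h 0%N)))) => //.
    by rewrite aE (block_sum_at bh r0 h0) mulf_neq0// invr_eq0 gt_eqF.
  move=> i; rewrite aE normrM gtr0_norm ?invr_gt0//.
  rewrite -[leRHS](@mulVf _ (weight a ks)%:R) ?gt_eqF//.
  rewrite ler_wpM2l ?invr_ge0//.
  have w1R : 1 <= (weight a ks)%:R :> R by rewrite ler1n ltnW.
  have [/existsP[q hq]|] := boolP [exists q : 'I_r, h q i != 0].
    rewrite (block_sum_at bh (ltn_ord q) hq).
    by have [_ _ /(_ i) hl] := hG _ (ltn_ord q); exact: le_trans hl w1R.
  rewrite negb_exists => /forallP h0; rewrite fct_sumE big1 ?normr0 ?ltW// => q _.
  by apply/eqP; have := h0 q; rewrite negbK.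
Qed.

Lemma W_iw_bounded f : W f -> [/\ c00 f, supp f <> fset0 & forall i, `|f i| <= 1].
Proof. by move=> /(_ _ (conj norming_closed_bounded (@sub0set _ _))). Qed.

Lemma W_c00 f : W f -> c00 f. Proof. by case/W_iw_bounded. Qed.
Lemma W_supp f : W f -> supp f <> fset0. Proof. by case/W_iw_bounded. Qed.

Lemma has_weightS (G H : set vec) f w : G `<=` H ->
  has_weight a b G f w -> has_weight a b H f w.
Proof.
case: w => //= m GH [Gf [ks [r [h [p [bh hG] ad fE mE]]]]]; split; first exact: GH.
by exists ks, r, h; split => //; split => // q qr; exact/GH/hG.
Qed.

Lemma vfgS (G H : set vec) r h : G `<=` H ->
  very_fast_growing a b G r h -> very_fast_growing a b H r h.
Proof.
move=> GH [w [hw lw]]; exists w; split => // q qr.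
exact: has_weightS (hw _ qr).
Qed.

(** Very fast growth refers to the set [G] itself. It is monotone in [G], so a sequence growing fast
    relative to [W] does so relative to every closed set containing [W], and closedness passes to
    the intersection. *)
Lemma W_closed : norming_closed a b W.
Proof.
split; first by move=> f /W_c00.
- by move=> i i0; split => G [[_ /(_ _ i0)[? ?] _] _].
- move=> ks r h pks bh hW ad vf G [nG _].
  have WG : W `<=` G by move=> f; apply; split.
  have [_ _] := nG; apply => //; last exact: vfgS vf.
  by move=> q qr; apply: WG; exact: hW.
Qed.

Lemma W_has_weight f w : has_weight a b W f w -> W f.
Proof.
case: w => [m /= []//|/= [i i0 fE]]; have [_ /(_ _ i0)[u1 u2] _] := W_closed.
by case: fE => ->.
Qed.

(** By minimality: the members of [W] of one of these two forms already constitute a closed set. *)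
Lemma W_inv f : W f ->
  (exists2 i : nat, (0 < i)%N & f = unit_vec i \/ f = - unit_vec i) \/
  exists ks r h, [/\ pos_list ks, block_seq r h, forall q, (q < r)%N -> W (h q),
    admissible (schreier_order b ks) r h & very_fast_growing a b W r h /\
      f = average a ks r h].
Proof.
pose V := W `&` [set f |
  (exists2 i : nat, (0 < i)%N & f = unit_vec i \/ f = - unit_vec i) \/
  exists ks r h, [/\ pos_list ks, block_seq r h, forall q, (q < r)%N -> W (h q),
    admissible (schreier_order b ks) r h & very_fast_growing a b W r h /\
      f = average a ks r h] ].
have VW : V `<=` W by move=> g [].
suff nV : norming_closed a b V by move=> /(_ V) []// _.
have [_ Wu Wa] := W_closed; split.
- by move=> g [/W_c00].
- by move=> i i0; have [u1 u2] := Wu _ i0; split; split=> //; left; exists i => //; [left|right].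
- move=> ks r h pks bh hV ad vf.
  have hW q : (q < r)%N -> W (h q) by move=> /hV /VW.
  have vfW := vfgS VW vf.
  split; first exact: Wa.
  by right; exists ks, r, h.
Qed.

(** Functionals in [W] have coefficients bounded by 1, so the l_1 norm of [x] is an upper bound and
    the supremum defining the norm is a genuine one. *)
Lemma norm_iw_has_sup x : c00 x -> has_sup [set pairing f x | f in W].
Proof.
move=> /c00P[_ [n xn]]; split.
  have [_ /(_ 1%N isT)[u _] _] := W_closed.
  by exists (pairing (unit_vec 1) x); exists (unit_vec 1).
exists (\sum_(i < n) `|x i|) => _ [f /W_iw_bounded[_ _ f1] <-].
rewrite (pairing_vecE _ xn); apply: ler_sum => i _.
rewrite (le_trans (ler_norm _))// normrM -[leRHS]mul1r.
by rewrite ler_wpM2r.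
Qed.

Lemma pairing_le_norm f x : W f -> c00 x -> pairing f x <= norm_iw a b x.
Proof.
move=> Wf /norm_iw_has_sup hs; apply: sup_upper_bound => //=.
by exists f.
Qed.

Lemma norm_iw_gt x t : c00 x -> t < norm_iw a b x ->
  exists2 f, W f & t < pairing f x.
Proof.
move=> /norm_iw_has_sup[ne _] /(sup_gt ne)[_ [f Wf <-] ft].
by exists f.
Qed.

End NormingSet.

(** * Very fast growing sequences of weighted functionals *)

Section Chunks.
Context {R : realType} (a b : nat -> nat).
Context (a_ge2 : forall k, (0 < k)%N -> (1 < a k)%N).

Local Notation vec := (nat -> R).
Local Notation W := (@W_iw R a b).
Local Notation wfun := ((nat -> R) * option nat)%type.
Implicit Types (z f : vec) (ks : seq nat) (s : seq wfun).

Definition mins s : {fset nat} := [fset q in [seq fsmin (supp p.1) | p <- s]]%fset.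

Definition total s : vec := \sum_(p <- s) p.1.

Definition weighted s := forall p, p \in s -> has_weight a b W p.1 p.2.

(* A weighted functional is paired with one of its weights.  Besides being very
   fast growing, the sequence may be placed after any very fast growing sequence
   supported in [1, k]. *)
Fixpoint fast_from (k : nat) s : Prop :=
  if s is p :: s' then
    [/\ (k < fsmin (supp p.1))%N, lt_weight k p.2 & fast_from (fsmax (supp p.1)) s']
  else True.

(* For [ks = [::]] this is a single functional of weight larger than [k]. *)
Definition chunk k ks s :=
  [/\ s != [::], weighted s, fast_from k s & schreier (schreier_order b ks) (mins s)].

Lemma mem_mins s (x : nat) :
  reflect (exists2 p, p \in s & x = fsmin (supp p.1)) (x \in mins s).
Proof. by rewrite /mins inE; exact: mapP. Qed.

Lemma lt_weight_le k k' w : (k' <= k)%N -> lt_weight k w -> lt_weight k' w.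
Proof. by case: w => //= m; exact: leq_ltn_trans. Qed.

Lemma fast_from_le k k' s : (k' <= k)%N -> fast_from k s -> fast_from k' s.
Proof.
case: s => //= p s kk [h1 h2 h3]; split => //; first exact: leq_ltn_trans h1.
exact: lt_weight_le h2.
Qed.

Lemma fast_from_cat k B s s' : fast_from k s -> (k <= B)%N ->
  (forall p, p \in s -> (fsmax (supp p.1) <= B)%N) ->
  fast_from B s' -> fast_from k (s ++ s').
Proof.
elim: s k => [|p s IH] k /=; first by move=> _ kB _; exact: fast_from_le.
move=> [h1 h2 h3] kB sB fs'; split => //; apply: IH => //.
  by apply: sB; rewrite mem_head.
by move=> q qs; apply: sB; rewrite inE qs orbT.
Qed.

Lemma weighted_W s p : weighted s -> p \in s -> W p.1.
Proof. by move=> gs /gs; exact: W_has_weight. Qed.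

Lemma weighted_cons p s : weighted (p :: s) -> weighted s.
Proof. by move=> gs q qs; apply: gs; rewrite inE qs orbT. Qed.

Lemma total_c00 s : weighted s -> c00 (total s).
Proof. by move=> gs; apply: c00_sum => p /(weighted_W gs) /(W_c00 a_ge2). Qed.

Lemma fast_from_gt k s p : weighted s -> fast_from k s -> p \in s ->
  (k < fsmin (supp p.1))%N.
Proof.
elim: s k => // q s IH k gs /= [h1 h2 h3]; rewrite inE => /orP[/eqP->//|ps].
have Wq : W q.1 by apply: (weighted_W gs); rewrite mem_head.
apply: leq_ltn_trans (IH _ (weighted_cons gs) h3 ps).
exact: leq_trans (ltnW h1) (fsmin_le_max (W_supp a_ge2 Wq)).
Qed.

Lemma fast_from_pairwise k s : weighted s -> fast_from k s ->
  pairwise (fun p q : wfun => (fsmax (supp p.1) < fsmin (supp q.1))%N) s.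
Proof.
elim: s k => // p s IH k gs /= [_ _ fs]; rewrite (IH _ (weighted_cons gs) fs) andbT.
by apply/allP => q; exact: fast_from_gt (weighted_cons gs) fs.
Qed.

Lemma fast_from_nth (p0 : wfun) k s q : fast_from k s -> (q.+1 < size s)%N ->
  (fsmax (supp (nth p0 s q).1) < fsmin (supp (nth p0 s q.+1).1))%N /\
  lt_weight (fsmax (supp (nth p0 s q).1)) (nth p0 s q.+1).2.
Proof.
elim: s k q => // p [|p' s] IH k [|q] //=; first by move=> [_ _ []].
by move=> [_ _ fs] qs; exact: (IH _ q fs qs).
Qed.

(** Passes from lists back to the indexed sequences of the norming set; the default [p0] is only
    read past the end of the list. *)
Lemma average_weight k ks s : pos_list ks -> chunk k ks s ->
  has_weight a b W (((weight a ks)%:R)^-1 *: total s) (Some (weight a ks)).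
Proof.
move=> pks [s0 gs fs sch].
pose p0 : wfun := (0, None).
pose h q := (nth p0 s q).1.
have ss : (0 < size s)%N by case: (s) s0.
have memh q : (q < size s)%N -> nth p0 s q \in s by move=> qs; exact: mem_nth.
have hW q : (q < size s)%N -> W (h q) by move=> /memh; exact: weighted_W.
have bh : block_seq (size s) h.
  split => // q qs; last by case: (fast_from_nth p0 fs qs).
  have Wh := hW _ qs.
  by split; [exact: W_c00 Wh|exact: W_supp Wh].
have ad : admissible (schreier_order b ks) (size s) h.
  rewrite /admissible; suff -> : [seq fsmin (supp (h q)) | q <- iota 0 (size s)] =
    [seq fsmin (supp p.1) | p <- s] by [].
  by rewrite -[in RHS](mkseq_nth p0 s) -map_comp.
have vf : very_fast_growing a b W (size s) h.
  exists (fun q => (nth p0 s q).2); split; first by move=> q /memh /gs.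
  by move=> q qs; case: (fast_from_nth p0 fs qs).
have E : ((weight a ks)%:R)^-1 *: total s = average a ks (size s) h.
  by rewrite /total /average (big_nth p0) big_mkord.
rewrite E; split; first by case: (@W_closed R _ b a_ge2) => _ _; apply.
by exists ks, (size s), h; split.
Qed.

Lemma total_neq0 s i : total s i != 0 -> exists2 p, p \in s & p.1 i != 0.
Proof.
move=> h; have : [exists p : seq_sub s, (val p).1 i != 0].
  apply: contraNT h; rewrite negb_exists => /forallP h.
  rewrite /total fct_sumE big_seq big1// => p ps.
  by have := h (SeqSub ps); rewrite negbK => /eqP.
by move=> /existsP[p hp]; exists (val p) => //; exact: valP.
Qed.

Lemma total_gt k s i : weighted s -> fast_from k s -> total s i != 0 -> (k < i)%N.
Proof.
move=> gs fs /total_neq0[p ps pi].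
apply: leq_trans (fast_from_gt gs fs ps) _.
by have := suppP (W_c00 a_ge2 (weighted_W gs ps)) pi; case/andP.
Qed.

Lemma order0 : schreier_order b [::] = 0%N.
Proof. by rewrite /schreier_order big_nil. Qed.

(** The empty list has Schreier order 0, and members of S_0 are the singletons. *)
Lemma chunk1 k f w : (k < fsmin (supp f))%N -> lt_weight k w -> has_weight a b W f w ->
  chunk k [::] [:: (f, w)].
Proof.
move=> kf kw hw; split => //; first by move=> p; rewrite inE => /eqP ->.
rewrite order0; exists (fsmin (supp f)); first exact: leq_ltn_trans kf.
by apply/fsetP => x; rewrite /mins /= !inE orbF.
Qed.

Lemma total1 f w : total [:: (f, w)] = f.
Proof. by rewrite /total big_seq1. Qed.

Lemma weight0 : weight a [::] = 1%N.
Proof. by rewrite /weight big_nil. Qed.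

Lemma fast_from_iota (h : nat -> vec) (w : nat -> option nat) m n :
  (forall q, (m <= q < m + n)%N -> (fsmax (supp (h q)) < fsmin (supp (h q.+1)))%N) ->
  (forall q, (m <= q < m + n)%N -> lt_weight (fsmax (supp (h q))) (w q.+1)) ->
  fast_from (fsmax (supp (h m))) [seq (h q, w q) | q <- iota m.+1 n].
Proof.
elim: n m => //= n IH m h1 h2.
split; [apply: h1; lia|apply: h2; lia|apply: IH => q qm; [apply: h1|apply: h2]; lia].
Qed.

(** Write [f] as an average of weight w. Pieces supported in [1, k] vanish on [z], and the first
    piece passing [k] contributes at most [N / w], which is at most [N / 2]. The other pieces
    therefore retain [N / 4], and by very fast growth their weights exceed [k]. The threshold [M]
    separates the large weights, where the truncated average is used as a single functional, from
    the small ones, where its pieces are kept. *)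
Lemma W_chunk (k M : nat) f z : (M <= k)%N -> W f -> c00 z ->
  (forall i, (i <= k)%N -> z i = 0) -> 3 / 4 * norm_iw a b z < pairing f z ->
  0 < norm_iw a b z ->
  (exists2 s, chunk M [::] s & norm_iw a b z / 4 <= pairing (total s) z) \/
  (exists ks s, [/\ pos_list ks, (weight a ks <= M)%N, chunk k ks s &
     norm_iw a b z / 4 <= ((weight a ks)%:R)^-1 * pairing (total s) z]).
Proof.
move=> Mk Wf cz zk fz N0; set N := norm_iw a b z in fz N0 *.
have [[i i0 fE]|[ks [r [h [pks bh hW ad [[w [hw lw]] fE]]]]]] := W_inv a_ge2 Wf.
  left; exists [:: (f, None)]; last by rewrite total1; lra.
  (* A signed unit vector has infinite weight, so only the position of [i] beyond [k] has to be
     checked. *)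
  apply: chunk1 => //; last by exists i.
  have supf x : f x != 0 -> x = i.
    by case: fE => ->; rewrite ?opprfctE ?oppr_eq0 /unit_vec pnatr_eq0 eqb0 negbK => /eqP.
  have ik : (k < i)%N.
    rewrite ltnNge; apply/negP => ik; suff fz0 : pairing f z = 0 by lra.
    by apply: pairing_disj => x /supf ->; exact: zk.
  apply: leq_ltn_trans Mk _; apply: leq_trans ik _.
  apply: leq_fsmin; first exact: W_supp Wf.
  by move=> x; rewrite (in_supp _ (W_c00 a_ge2 Wf)) => /supf ->.
have [r0 hc _] := bh.
have w1 := weight_gt1 a_ge2 pks.
have w2R : 2 <= (weight a ks)%:R :> R by rewrite (ler_nat _ 2).
have w0 : (weight a ks)%:R != 0 :> R by apply: lt0r_neq0; lra.
have hfz : (weight a ks)%:R * pairing f z = \sum_(0 <= q < r) pairing (h q) z.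
  rewrite fE pairingZl// mulrA mulfV ?mul1r ?pairing_suml ?big_mkord//.
have low q : (q < r)%N -> (fsmax (supp (h q)) <= k)%N -> pairing (h q) z = 0.
  move=> qr hk; apply: pairing_disj => x hx; apply: zk.
  by have := suppP (hc _ qr).1 hx; lia.
pose P q := (q < r)%N && (k < fsmax (supp (h q)))%N.
have exP : exists q, P q.
  apply: contrapT => nP; suff : pairing f z = 0 by lra.
  suff S0 : \sum_(0 <= q < r) pairing (h q) z = 0.
    by apply: (mulfI w0); rewrite hfz S0 mulr0.
  rewrite big_nat big1// => q /andP[_ qr]; apply: low => //.
  by rewrite leqNgt; apply/negP => kq; apply: nP; exists q; rewrite /P qr.
case: (ex_minnP exP) => q0 /andP[q0r kq0] q0min.
pose s := [seq (h q, w q) | q <- iota q0.+1 (r - q0.+1)].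
have mem_s p : p \in s -> exists2 q, (q0 < q < r)%N & p = (h q, w q).
  by move=> /mapP[q]; rewrite mem_iota => qi ->; exists q => //; lia.
have tots : pairing (total s) z = \sum_(q0.+1 <= q < r) pairing (h q) z.
  by rewrite /total pairing_suml// big_map /index_iota.
have hfz2 : (weight a ks)%:R * pairing f z = pairing (h q0) z + pairing (total s) z.
  rewrite hfz (big_cat_nat (n := q0))//=; last exact: ltnW.
  rewrite big_nat big1 ?add0r; last first.
    move=> q /andP[_ qq]; apply: low; first exact: ltn_trans qq q0r.
    rewrite leqNgt; apply/negP => kq; suff : (q0 <= q)%N by lia.
    by apply: q0min; rewrite /P kq (ltn_trans qq).
  by rewrite big_ltn// tots.
have hq0 := pairing_le_norm a_ge2 (hW _ q0r) cz; rewrite -/N in hq0.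
(* With w the weight, [3 / 4 * N * w < N + pairing (total s) z]; since w is at least 2, [N] is at
   most [N * w / 2]. *)
have tsz : N / 4 <= ((weight a ks)%:R)^-1 * pairing (total s) z.
  rewrite [leRHS]mulrC ler_pdivlMr; last by lra.
  have : 3 / 4 * N * (weight a ks)%:R < pairing f z * (weight a ks)%:R.
    by rewrite ltr_pM2r//; lra.
  have : 0 <= N * ((weight a ks)%:R - 2) by rewrite mulr_ge0 ?subr_ge0// ltW.
  by lra.
have ts0 : 0 < pairing (total s) z.
  rewrite -(pmulr_rgt0 (x := ((weight a ks)%:R)^-1)) ?invr_gt0; last lra.
  by apply: lt_le_trans tsz; lra.
have s0 : s != [::].
  by apply: contraTneq ts0 => ->; rewrite /total big_nil pairing0l ltxx.
have q1r : (q0.+1 < r)%N.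
  rewrite ltnNge; apply: contra s0 => rq.
  by rewrite /s (eqP (_ : (r - q0.+1)%N == 0%N))// subn_eq0.
have gs : weighted s by move=> p /mem_s[q /andP[_ qr] ->]; exact: hw.
have fs : fast_from (fsmax (supp (h q0))) s.
  by apply: fast_from_iota => q qq; [apply: block_lt bh _ _|apply: lw]; lia.
have ck : chunk k ks s.
  split => //; first exact: fast_from_le (ltnW kq0) fs.
  (* The minima increase strictly, so those of the retained pieces form the final segment starting
     at the minimum of piece [q0.+1]. *)
  apply: (schreier_tail (p := fsmin (supp (h q0.+1))) ad).
    apply: (@fset_neq0 _ (fsmin (supp (h q0.+1)))); apply/mem_mins.
    by exists (h q0.+1, w q0.+1) => //; apply/mapP; exists q0.+1 => //; rewrite mem_iota; lia.
  have mono q q' : (q < q')%N -> (q' < r)%N ->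
      (fsmin (supp (h q)) < fsmin (supp (h q')))%N.
    move=> qq qr; apply: leq_ltn_trans (block_lt bh qq qr).
    by apply: fsmin_le_max; apply: (hc _ _).2; lia.
  have mem_h y : (y \in [fset q in [seq fsmin (supp (h q)) | q <- iota 0 r]]%fset) =
    (y \in [seq fsmin (supp (h q)) | q <- iota 0 r]) by rewrite inE.
  move=> x; rewrite mem_h; apply/mem_mins/andP.
    move=> [_ /mem_s[q qq ->] ->] /=; split.
      by apply/mapP; exists q => //; rewrite mem_iota; lia.
    have [->//|qn] := eqVneq q q0.+1.
    by apply/ltnW/mono; lia.
  move=> [/mapP[q]]; rewrite mem_iota => qr -> qge.
  exists (h q, w q) => //; apply/mapP; exists q => //; rewrite mem_iota.
  have [qq|qq] := leqP q q0; last by lia.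
  have : (fsmin (supp (h q)) < fsmin (supp (h q0.+1)))%N by apply: mono; lia.
  by lia.
have [wM|Mw] := leqP (weight a ks) M; [right; by exists ks, s|left].
have hwA := average_weight pks ck.
exists [:: (((weight a ks)%:R)^-1 *: total s, Some (weight a ks))].
  have Wg := W_has_weight a_ge2 hwA.
  apply: chunk1 => //.
  have := fsmin_supp (W_c00 a_ge2 Wg) (W_supp a_ge2 Wg).
  set i := fsmin _ => hi; apply: leq_ltn_trans Mk _.
  have [_ _ fk _] := ck; apply: (total_gt gs fk (i := i)).
  by apply: contraNneq hi => t0; rewrite !fctE t0 scaler0.
by rewrite total1 pairingZl.
Qed.

(** Every functional of one chunk ends before every functional of the next begins, so the sets of
    minima are successive too. Chunks must be nonempty for their minima to make sense. *)
Lemma mins_flatten k (cs : seq (seq wfun)) i :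
  weighted (flatten cs) -> fast_from k (flatten cs) ->
  (forall c, c \in cs -> c != [::]) -> (i.+1 < size cs)%N ->
  (fsmax (mins (nth [::] cs i)) < fsmin (mins (nth [::] cs i.+1)))%N.
Proof.
move=> gs /(fast_from_pairwise gs) + cs0; move: gs => gs.
elim: cs i cs0 gs => // c cs IH i cs0 gs; rewrite /= pairwise_cat => /and3P[/allrelP al _ pw].
case: i => [|i] /= ic; last first.
  apply: IH => // [c' c'cs|p pf]; first by apply: cs0; rewrite inE c'cs orbT.
  by apply: gs; rewrite /= mem_cat pf orbT.
set c' := nth _ _ 0.
have c'cs : c' \in cs by apply: mem_nth.
have c'0 : c' != [::] by apply: cs0; rewrite inE c'cs orbT.
have c'f p : p \in c' -> p \in flatten cs by move=> ?; apply/flattenP; exists c'.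
have : mins c' <> fset0.
  case: (c') c'0 => // p ? _; apply: (@fset_neq0 _ (fsmin (supp p.1))).
  by apply/mem_mins; exists p => //; rewrite mem_head.
move/fsmin_in/mem_mins => [p /c'f pc ->].
have lt q : q \in c -> (fsmin (supp q.1) < fsmin (supp p.1))%N.
  move=> qc; apply: leq_ltn_trans (al _ _ qc pc).
  apply: fsmin_le_max; apply: (W_supp a_ge2 (b := b)); apply: (weighted_W gs).
  by rewrite /= mem_cat qc.
have : mins c <> fset0.
  have : c != [::] by apply: cs0; rewrite mem_head.
  case: (c) => // q ? _; apply: (@fset_neq0 _ (fsmin (supp q.1))).
  by apply/mem_mins; exists q => //; rewrite mem_head.
move=> mc0; have p0 : (0 < fsmin (supp p.1))%N.
  by have /mem_mins[q /lt + _] := fsmin_in mc0; exact: leq_ltn_trans.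
rewrite -(prednK p0) ltnS; apply: fsmax_leq => x /mem_mins[q /lt + ->].
by lia.
Qed.

(** Prepending 1 to [ks] doubles the weight and raises the Schreier order by one. The raised order
    accommodates the union of all chunks: there are at most [k] of them and all are supported beyond
    [k]. *)
Lemma W_join k ks (cs : seq (seq wfun)) : a 1%N = 2%N -> b 1%N = 1%N ->
  ks = [::] \/ pos_list ks ->
  cs != [::] -> (size cs <= k)%N -> fast_from k (flatten cs) ->
  (forall c, c \in cs -> chunk 0 ks c) ->
  W ((2 * (weight a ks)%:R)^-1 *: total (flatten cs)).
Proof.
move=> a1 b1 pks cs0 ck fk cc.
have cc0 c : c \in cs -> c != [::] by move=> /cc[].
have scs : (0 < size cs)%N by case: (cs) cs0.
have gs : weighted (flatten cs).
  by move=> p /flattenP[c /cc[_ gc _ _]]; exact: gc.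
have wE : weight a (1%N :: ks) = (2 * weight a ks)%N by rewrite /weight big_cons a1.
rewrite -natrM -wE.
suff cj : chunk k (1%N :: ks) (flatten cs).
  apply: (W_has_weight a_ge2); apply: (average_weight _ cj).
  by case: pks => [->|[_ aks]].
have f0 : flatten cs != [::].
  case: (cs) cs0 cc0 => //= c cs' _ /(_ c (mem_head _ _)).
  by case: c.
split => //; rewrite /schreier_order big_cons b1 add1n -/(schreier_order b ks).
apply: (@schreierS _ _ (size cs) (fun i => mins (nth [::] cs i))) => //.
- move=> x; split=> [/mem_mins[p /flattenP[c ccs pc] ->]|[i ics /mem_mins[p pi ->]]].
    exists (index c cs); first by rewrite index_mem.
    by rewrite nth_index//; apply/mem_mins; exists p.
  by apply/mem_mins; exists p => //; apply/flattenP; exists (nth [::] cs i) => //; exact: mem_nth.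
- by move=> i ics; exact: mins_flatten fk _ _.
- by move=> i ics; have /cc[] := mem_nth [::] ics.
- have c0 := mem_nth [::] scs; have [_ _ _ /schreier_neq0 m0] := cc _ c0.
  have /mem_mins[p pc ->] := fsmin_in m0.
  apply: leq_trans ck (ltnW _); apply: fast_from_gt gs fk _.
  by apply/flattenP; exists (nth [::] cs 0).
Qed.

End Chunks.

(** * Negligible sets and Riemann sums *)

Section Content.
Context {R : realType}.

Lemma negligible_small_cover (E : set R) :
  (forall eta : R, 0 < eta -> exists B : set R,
     [/\ measurable B, E `<=` B & (lebesgue_measure B <= eta%:E)%E]) ->
  (@lebesgue_measure R).-negligible E.
Proof.
move=> h.
have h' n : exists B : set R, [/\ measurable B, E `<=` B &
    (lebesgue_measure B <= (n.+1%:R^-1)%:E)%E] by apply: h; rewrite invr_gt0.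
have [B hB] := choice h'.
have mB : measurable (\bigcap_n B n) by apply: bigcap_measurable => // n _; case: (hB n).
exists (\bigcap_n B n); split => //; last by move=> x Ex n _; case: (hB n) => _ /(_ x Ex).
apply/eqP; rewrite eq_le measure_ge0 andbT.
apply/lee_addgt0Pr => e /ltr_add_invr[k]; rewrite !add0r => ke.
have [mBk _ Bk] := hB k.
apply: (@le_trans _ _ (lebesgue_measure (B k))).
  by apply: le_measure; rewrite ?inE//; exact: bigcap_inf.
by rewrite ?add0e (le_trans Bk)// lee_fin ltW.
Qed.

Lemma negligible_bigcup_count (T : countType) (G : T -> set R) :
  (forall c, (@lebesgue_measure R).-negligible (G c)) ->
  (@lebesgue_measure R).-negligible (\bigcup_c G c).
Proof.
move=> hG; pose F m := if choice.unpickle m is Some c then G c else set0.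
have hF m : (@lebesgue_measure R).-negligible (F m).
  by rewrite /F; case: choice.unpickle => [c|]; [exact: hG|exact: negligible_set0].
apply: negligibleS (negligible_bigcup hF) => x [c _ Gx].
by exists (choice.pickle c) => //; rewrite /F choice.pickleK.
Qed.

(** On a fine uniform partition, tag the intervals meeting [E] first by points [t i] of [E], then by
    nearby points [s i]. The two Riemann sums are close to each other, yet differ by at least [c]
    times the total length of these intervals. Hence that length, which bounds the outer measure of
    [E], is small. Points of [E] are irrational, so they are interior to the intervals. *)
Lemma negligible_of_sum_ge (X : completeNormedModType R) (f : R -> X)
    (E : set R) (c : R) :
  riemann_integrable f -> 0 < c ->
  (forall x, E x -> 0 <= x <= 1 /\ ~ range ratr x) ->
  (forall (H : seq nat) (t rho : nat -> R), uniq H ->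
     (forall i, i \in H -> E (t i) /\ 0 < rho i) ->
     exists s : nat -> R, (forall i, i \in H -> `|s i - t i| < rho i) /\
       c * (size H)%:R <= `|\sum_(i <- H) (f (s i) - f (t i))|) ->
  (@lebesgue_measure R).-negligible E.
Proof.
move=> [xf If] c0 E01 hE; apply: negligible_small_cover => eta eta0.
have eps0 : 0 < c * eta / 2 by rewrite divr_gt0// mulr_gt0.
have [delta delta0 {}If] := If _ eps0.
have [k] := ltr_add_invr delta0; rewrite add0r; set N := k.+1 => Nd.
have N0 : 0 < N%:R :> R by rewrite ltr0n.
pose p (i : nat) : R := i%:R / N%:R.
have pS i : p i.+1 - p i = N%:R^-1 by rewrite /p -natr1; field; rewrite gt_eqF.
have pN : p N = 1 by rewrite /p divff// gt_eqF.
pose P i := `[< exists2 x, E x & p i < x < p i.+1 >].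
pose H := [seq i <- iota 0 N | P i].
have mH i : (i \in H) = P i && (i < N)%N by rewrite mem_filter mem_iota add0n.
have /choice[t ht] : forall i, exists x, P i -> E x /\ p i < x < p i.+1.
  move=> i; have [/asboolP[x Ex px]|nP] := boolP (P i); first by exists x.
  by exists 0 => Pi; case/negP: nP.
(* This radius keeps [s i] in the same interval as [t i]. *)
pose rho i := Num.min (t i - p i) (p i.+1 - t i).
have [||s [hs cs]] := hE H t rho; first by rewrite filter_uniq ?iota_uniq.
  move=> i; rewrite mH => /andP[/ht[Ei ti] _]; split => //.
  by rewrite lt_min !subr_gt0.
(* Intervals missing [E] receive the same tag in both sums, and their terms cancel. *)
pose tag (u : nat -> R) i := if P i then u i else p i.
have tagP u : (forall i, i \in H -> p i <= u i <= p i.+1) ->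
    forall i, (i < N)%N -> p i <= tag u i <= p i.+1.
  move=> hu i iN; rewrite /tag; case: ifP => Pi; first by apply: hu; rewrite mH Pi.
  by rewrite lexx -subr_ge0 pS invr_ge0 ltW.
have hI u : (forall i, i \in H -> p i <= u i <= p i.+1) ->
    `|xf - \sum_(i < N) (p i.+1 - p i) *: f (tag u i)| < c * eta / 2.
  move=> hu; apply: If => //; first by rewrite /p mul0r.
  - by move=> i _; rewrite -subr_gt0 pS invr_gt0.
  - by move=> i _; rewrite pS.
  - exact: tagP.
have hIt : `|xf - \sum_(i < N) (p i.+1 - p i) *: f (tag t i)| < c * eta / 2.
  by apply: hI => i; rewrite mH => /andP[/ht[_ /andP[/ltW-> /ltW->]]].
have hIs : `|xf - \sum_(i < N) (p i.+1 - p i) *: f (tag s i)| < c * eta / 2.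
  apply: hI => i iH; have := hs _ iH; rewrite lt_min !ltr_norml.
  by move=> /andP[/andP[h1 h2] /andP[h3 h4]]; apply/andP; split; lra.
have key : \sum_(i < N) (p i.+1 - p i) *: f (tag s i) -
    \sum_(i < N) (p i.+1 - p i) *: f (tag t i) =
    N%:R^-1 *: \sum_(i <- H) (f (s i) - f (t i)).
  rewrite -sumrB /H big_filter scaler_sumr.
  rewrite [LHS](eq_bigr (fun i : 'I_N => if P i then N%:R^-1 *: (f (s i) - f (t i)) else 0)).
    by rewrite -(big_mkord xpredT (fun i => if P i then N%:R^-1 *: (f (s i) - f (t i)) else 0)) /index_iota subn0 -big_mkcond.
  move=> i _; rewrite pS -scalerBr /tag; case: ifP => // _.
  by rewrite subrr scaler0.
have szH : (size H)%:R / N%:R <= eta.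
  have : `|N%:R^-1 *: \sum_(i <- H) (f (s i) - f (t i))| < c * eta.
    rewrite -key; set A := \sum_(i < N) _; set B := \sum_(i < N) _.
    rewrite -/A -/B in hIt hIs *.
    have -> : A - B = (xf - B) - (xf - A).
      by rewrite opprB [RHS]addrC addrA subrK.
    apply: le_lt_trans (ler_normB _ _) _; lra.
  rewrite normrZ ger0_norm ?invr_ge0 ?ler0n// => hlt.
  have : N%:R^-1 * (c * (size H)%:R) <= N%:R^-1 * `|\sum_(i <- H) (f (s i) - f (t i))|.
    by rewrite ler_wpM2l// invr_ge0 ltW.
  move=> /le_lt_trans /(_ hlt); rewrite mulrCA ltr_pM2l// mulrC.
  exact: ltW.
pose F i : set R := if P i then `[p i, p i.+1]%classic else set0.
have mF i : measurable (F i) by rewrite /F; case: ifP => _ //; exact: measurable_itv.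
have muF i : lebesgue_measure (F i) = (if P i then N%:R^-1 else 0)%:E.
  rewrite /F; case: ifP => _; last by rewrite measure0.
  have pi : p i < p i.+1 by rewrite -subr_gt0 pS invr_gt0.
  by rewrite lebesgue_measure_itv/= lte_fin pi -EFinB pS.
exists (\big[setU/set0]_(i < N) F i); split.
- exact: bigsetU_measurable.
- move=> x Ex; have [/andP[x0 x1] xQ] := E01 _ Ex.
  have notp i : x <> p i.
    move=> xp; apply: xQ; exists (i%:R / N%:R) => //.
    by rewrite fmorph_div /= !ratr_nat xp.
  have xN0 : 0 <= x * N%:R by rewrite mulr_ge0// ltW.
  have /andP[lo hi] := truncn_itv xN0; set i := Num.truncn _ in lo hi.
  have lo' : p i < x.
    by rewrite lt_neqAle /p ler_pdivrMr// lo andbT; apply/eqP => /esym/notp.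
  have hi' : x < p i.+1 by rewrite /p ltr_pdivlMr.
  have x1' : x < 1 by rewrite lt_neqAle x1 andbT -pN; apply/eqP/notp.
  have iN : (i < N)%N.
    rewrite -(ltr_nat R); apply: (le_lt_trans lo).
    by rewrite -[ltRHS]mul1r ltr_pM2r.
  rewrite -bigcup_mkord; exists i => //; rewrite /F ifT; first by rewrite /= in_itv/= !ltW.
  by apply/asboolP; exists x => //; rewrite lo'.
- apply: (le_trans (Boole_inequality _ _)) => [i _|]; first exact: mF.
  rewrite (eq_bigr (fun i : 'I_N => (if P i then N%:R^-1 else 0)%:E)).
    rewrite sumEFin lee_fin (le_trans _ szH)//.
    rewrite -(big_mkord xpredT (fun i => if P i then N%:R^-1 else 0)) -big_mkcond /=.
    rewrite -big_filter /index_iota subn0 -/H big_const_seq count_predT iter_addr_0.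
    by rewrite mulr_natl.
  by move=> i _; exact: muF.
Qed.

End Content.

(** * Discontinuities of Riemann-integrable functions *)

Section LebesguePropertyXiw.
Context {R : realType} (a b : nat -> nat).
Context (a_ge2 : forall k, (0 < k)%N -> (1 < a k)%N).
Context (X : completeNormedModType R) (j : (nat -> R) -> X).
Context (Xiw : is_X_iw a b j).

Local Notation vec := (nat -> R).
Local Notation W := (@W_iw R a b).
Local Notation wfun := ((nat -> R) * option nat)%type.

Lemma j_add x y : c00 x -> c00 y -> j (x + y) = j x + j y.
Proof.
case: Xiw => jl _ _ cx cy; have := jl 1 x y cx cy.
by rewrite !scale1r.
Qed.

Lemma j_zero : j 0 = 0.
Proof.
have c0 := @c00_0 R; have := j_add c0 c0; rewrite addr0 => /eqP.
by rewrite -subr_eq0 opprD addNKr oppr_eq0 => /eqP.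
Qed.

Lemma j_scale (c : R) x : c00 x -> j (c *: x) = c *: j x.
Proof.
case: Xiw => jl _ _ cx; have := jl c x 0 cx (@c00_0 R).
by rewrite j_zero !addr0.
Qed.

Lemma j_sum (I : eqType) (s : seq I) (F : I -> vec) :
  (forall i, i \in s -> c00 (F i)) -> j (\sum_(i <- s) F i) = \sum_(i <- s) j (F i).
Proof.
elim: s => [|i s IH] cF; first by rewrite !big_nil j_zero.
have cs k : k \in s -> c00 (F k) by move=> ks; apply: cF; rewrite inE ks orbT.
rewrite !big_cons j_add ?IH//; first by apply: cF; rewrite mem_head.
exact: c00_sum.
Qed.

Lemma norm_j x : c00 x -> `|j x| = norm_iw a b x.
Proof. by case: Xiw => _ jn _; exact: jn. Qed.

Lemma j_dense (v : X) (e : R) : 0 < e -> exists2 y, c00 y & `|v - j y| < e.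
Proof.
move=> e0; case: Xiw => _ _ dj.
have ne : ball v e !=set0 by exists v; exact: ballxx.
have [w [vw [y cy yw]]] := dj _ ne (ball_open v e).
by exists y => //; rewrite yw; move: vw; rewrite -ball_normE.
Qed.

Context (f : R -> X).

(* The case [ks = [::]] for all [k] means that [f s - f x] is normed by functionals
   of arbitrarily large weight. *)
Definition witness (eps : R) (ks : seq nat) (k : nat) (x : R) : Prop :=
  exists s z (c : seq wfun), [/\ `|s - x| < k.+1%:R^-1,
    c00 z /\ (forall i, (i <= k)%N -> z i = 0),
    `|f s - f x - j z| <= eps / 32,
    chunk a b k ks c
    & eps / 8 <= ((weight a ks)%:R)^-1 * pairing (total c) z].

Lemma chunk_le k k' ks (c : seq wfun) : (k' <= k)%N -> chunk a b k ks c -> chunk a b k' ks c.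
Proof. by move=> kk [? ? fc ?]; split => //; exact: fast_from_le fc. Qed.

Lemma witness_le eps ks k k' x : (k' <= k)%N ->
  witness eps ks k x -> witness eps ks k' x.
Proof.
move=> kk [s [z [c [sx [cz zk] fz cc pc]]]]; exists s, z, c; split => //.
- by apply: lt_le_trans sx _; rewrite lef_pV2 ?posrE ?ler_nat.
- by split => // i ik; apply: zk; exact: leq_trans kk.
- exact: chunk_le cc.
Qed.

Lemma total_cat (c c' : seq wfun) : total (c ++ c') = total c + total c'.
Proof. by rewrite /total big_cat. Qed.

(** Witnesses are chosen one after another, each beyond the supports of all earlier vectors and
    functionals. Cross terms then vanish, so the pairings add up, and the concatenated chunks are
    still very fast growing. *)
Lemma witness_chain eps ks (H : seq nat) (t rho : nat -> R) (k : nat) :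
  uniq H -> (forall i, i \in H -> (forall l, witness eps ks l (t i)) /\ 0 < rho i) ->
  exists s z (cs : seq (seq wfun)),
  [/\ forall i, i \in H -> `|s i - t i| < rho i,
      c00 z /\ (forall i, (i <= k)%N -> z i = 0),
      `|\sum_(i <- H) (f (s i) - f (t i)) - j z| <= eps / 32 * (size H)%:R,
      [/\ size cs = size H, forall c, c \in cs -> chunk a b 0 ks c & fast_from k (flatten cs)]
    & eps / 8 * (size H)%:R <= ((weight a ks)%:R)^-1 * pairing (total (flatten cs)) z].
Proof.
elim: H k => [|i H IH] k /=.
  move=> _ _; exists (fun=> 0), 0, [::]; split => //.
  - by split => //; exact: c00_0.
  - by rewrite big_nil j_zero subrr normr0 mulr0.
  - by rewrite /total big_nil pairing0l !mulr0.
move=> /andP[iH uH] hH.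
have [wi ri] := hH i (mem_head _ _).
have [k1 ] := ltr_add_invr ri; rewrite add0r => k1r.
(* The index of a witness controls both position and distance: [k] pushes the supports out, [k1]
   brings [s1] within [rho i] of [t i]. *)
have [s1 [z1 [c1 [s1t [cz1 z1k] fz1 cc1 p1]]]] := wi (maxn k k1).
have [c10 gc1 fc1 sc1] := cc1.
have [_ [n z1n]] := (c00P z1).1 cz1.
pose B := maxn (maxn k n) (\max_(p <- c1) fsmax (supp p.1)).
have kB : (k <= B)%N by rewrite !leq_max leqnn.
have nB : (n <= B)%N by rewrite !leq_max leqnn orbT.
have cB p : p \in c1 -> (fsmax (supp p.1) <= B)%N.
  by move=> pc; rewrite /B (big_rem p pc)/= !leq_max leqnn !orbT.
have [//|l lH|s2 [z2 [cs2 [s2t [cz2 z2B] fz2 [sz2 cc2 fc2] p2]]]] := IH B.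
  by apply: hH; rewrite inE lH orbT.
have gc2 : weighted a b (flatten cs2).
  by move=> p /flattenP[c /cc2[_ gc _ _]]; exact: gc.
have eqs : \sum_(l <- H) (f (if l == i then s1 else s2 l) - f (t l)) =
           \sum_(l <- H) (f (s2 l) - f (t l)).
  by apply: eq_big_seq => l lH; case: eqP => // li; rewrite li (negbTE iH) in lH.
exists (fun l => if l == i then s1 else s2 l), (z1 + z2), (c1 :: cs2); split.
- move=> l; rewrite inE => /orP[/eqP->|lH].
    rewrite eqxx; apply: lt_trans k1r; apply: lt_le_trans s1t _.
    by rewrite lef_pV2 ?posrE ?ler_nat ?ltnS ?leq_maxr.
  by case: eqP => [li|_]; [rewrite li (negbTE iH) in lH|exact: s2t].
- split; first exact: c00D.
  move=> l lk; rewrite fctE z1k ?z2B ?addr0//; first exact: leq_trans kB.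
  by rewrite leq_max lk.
- rewrite big_cons eqxx eqs j_add// opprD addrACA.
  apply: le_trans (ler_normD _ _) _.
  by rewrite -[(size H).+1%:R]natr1 mulrDr mulr1 [leRHS]addrC lerD.
- split; first by rewrite /= sz2.
    move=> c; rewrite inE => /orP[/eqP->|/cc2//]; exact: chunk_le cc1.
  apply: (fast_from_cat _ kB cB fc2); apply: fast_from_le fc1.
  by rewrite leq_max leqnn.
- have ct1 := total_c00 a_ge2 gc1; have ct2 := total_c00 a_ge2 gc2.
  rewrite /= total_cat pairingDl; last exact: c00D.
  rewrite !pairingDr//.
  rewrite [pairing (total c1) z2]pairing_disj ?addr0; last first.
    move=> l /total_neq0[p pc pl]; apply: z2B.
    have := suppP (W_c00 a_ge2 (weighted_W a_ge2 gc1 pc)) pl.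
    by move=> /andP[_ lm]; exact: leq_trans lm (cB _ pc).
  rewrite [pairing (total (flatten cs2)) z1]pairing_disj ?add0r; last first.
    move=> l /(total_gt a_ge2 gc2 fc2) Bl; apply: z1n; exact: leq_trans nB (ltnW Bl).
  by rewrite -[(size H).+1%:R]natr1 mulrDr mulr1 mulrDr addrC lerD.
Qed.

(** Joining the chunks costs a factor 2, so the norm of [j z] is at least [eps / 16] times the
    number of points. The approximation errors take away at most [eps / 32] per point, leaving
    [eps / 32]. *)
Lemma negligible_witness eps ks : riemann_integrable f ->
  a 1%N = 2%N -> b 1%N = 1%N -> 0 < eps -> ks = [::] \/ pos_list ks ->
  (@lebesgue_measure R).-negligible
    [set x | [/\ 0 <= x <= 1, ~ range ratr x & forall k, witness eps ks k x]].
Proof.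
move=> If a1 b1 eps0 pks; apply: (@negligible_of_sum_ge _ _ f _ (eps / 32)) => //.
- by rewrite divr_gt0.
- by move=> x [].
move=> H t rho uH hH.
(* Starting the chain beyond [size H] makes the number of chunks admissible in [W_join]. *)
have [i iH|s [z [cs [st [cz zk] fz [sz cc fc] pc]]]] :=
    @witness_chain eps ks H t rho (size H) uH.
  by have [[]] := hH _ iH.
exists s; split => //.
have [H0|H0] := posnP (size H); first by rewrite H0 mulr0.
have cs0 : cs != [::] by rewrite -size_eq0 sz -lt0n.
have Wg := W_join a_ge2 a1 b1 pks cs0 (eq_leq sz) fc cc.
have := pairing_le_norm a_ge2 Wg cz.
rewrite pairingZl// -norm_j// invfM -mulrA => pz.
have tri : `|j z| <= `|\sum_(i <- H) (f (s i) - f (t i))| +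
    `|\sum_(i <- H) (f (s i) - f (t i)) - j z|.
  have {1}-> : j z = \sum_(i <- H) (f (s i) - f (t i)) -
     (\sum_(i <- H) (f (s i) - f (t i)) - j z) by rewrite opprB addrCA subrr addr0.
  exact: ler_normB.
lra.
Qed.

(** With the sign fixed, jumps of one coordinate add up without cancellation, and the signed unit
    functional, a member of [W], detects them: [e] per point, minus an error of at most [e / 2]. *)
Lemma negligible_coord (e : R) (i : nat) (sg : bool) :
  riemann_integrable f -> 0 < e -> (0 < i)%N ->
  (@lebesgue_measure R).-negligible
    [set x | [/\ 0 <= x <= 1, ~ range ratr x & forall rho : R, 0 < rho ->
      exists s y, [/\ `|s - x| < rho, c00 y, `|f s - f x - j y| <= e / 2
        & e <= (-1) ^+ sg * y i]]].
Proof.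
move=> If e0 i0; apply: (@negligible_of_sum_ge _ _ f _ (e / 2)) => //.
- by rewrite divr_gt0.
- by move=> x [].
move=> H t rho uH hH.
have /choice[s /choice[y hsy]] : forall l, exists s y, l \in H ->
    [/\ `|s - t l| < rho l, c00 y, `|f s - f (t l) - j y| <= e / 2 & e <= (-1) ^+ sg * y i].
  move=> l; have [lH|nl] := boolP (l \in H); last by exists 0, 0.
  have [[_ _ /(_ (rho l))] h /h[s [y hs]]] := hH _ lH.
  by exists s, y.
exists s; split; first by move=> l /hsy[].
have cy l : l \in H -> c00 (y l) by move=> /hsy[].
have cz := c00_sum cy.
have Wu : W ((-1) ^+ sg *: unit_vec i).
  have [_ /(_ _ i0)[u1 u2] _] := @W_closed R a b a_ge2.
  by case: sg {hH hsy}; rewrite ?expr1 ?scaleN1r// expr0 scale1r.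
have := pairing_le_norm a_ge2 Wu cz.
rewrite -norm_j// pairingZl; last exact: cz.
have sE : (\sum_(l <- H) y l) i = \sum_(l <- H) y l i by rewrite fct_sumE.
rewrite pairing_unit// sE mulr_sumr => hz.
have lo : e * (size H)%:R <= \sum_(l <- H) (-1) ^+ sg * y l i.
  rewrite mulr_natr -(count_predT H) -iter_addr_0 -big_const_seq.
  rewrite big_seq [leRHS]big_seq; apply: ler_sum => l /hsy[] //.
have up : `|\sum_(l <- H) (f (s l) - f (t l)) - j (\sum_(l <- H) y l)| <= e / 2 * (size H)%:R.
  rewrite j_sum// -sumrB (le_trans (ler_norm_sum _ _ _))//.
  rewrite mulr_natr -(count_predT H) -iter_addr_0 -big_const_seq.
  by rewrite big_seq [leRHS]big_seq; apply: ler_sum => l /hsy[].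
set S := \sum_(l <- H) (f (s l) - f (t l)) in up *.
set z := \sum_(l <- H) y l in up hz cz.
have tri : `|j z| <= `|S| + `|S - j z|.
  have {1}-> : j z = S - (S - j z) by rewrite opprB addrCA subrr addr0.
  exact: ler_normB.
lra.
Qed.

(** * Discontinuity points at which all coordinates are continuous *)

Section BadPoint.
Context (x : R).
Context (coord : forall m i : nat,
  exists2 rho : R, 0 < rho & forall s y, `|s - x| < rho -> c00 y ->
    `|f s - f x - j y| <= m.+1%:R^-1 / 2 -> `|y i.+1| < m.+1%:R^-1).
Context (eps : R).
Context (eps0 : 0 < eps).
Context (osc : forall rho : R, 0 < rho ->
  exists2 s, `|s - x| < rho & eps <= `|f s - f x|).

Lemma coord_finite m k : exists2 rho : R, 0 < rho & forall s y,
  `|s - x| < rho -> c00 y -> `|f s - f x - j y| <= m.+1%:R^-1 / 2 ->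
  forall i, (i < k)%N -> `|y i.+1| < m.+1%:R^-1.
Proof.
elim: k => [|k [r1 r10 h1]]; first by exists 1.
have [r2 r20 h2] := coord m k.
exists (Num.min r1 r2); first by rewrite lt_min r10.
move=> s y; rewrite lt_min => /andP[s1 s2] cy fy i.
rewrite ltnS leq_eqVlt => /orP[/eqP->|ik]; first exact: h2 fy.
exact: h1 s1 cy fy _ ik.
Qed.

(** A large difference [f s - f x] is approximated by a finitely supported [y], whose first [k]
    coordinates are then deleted; near [x] they are so small that this barely changes the vector. *)
Lemma tail_difference k : exists s z, [/\ `|s - x| < k.+1%:R^-1, c00 z,
  forall i, (i <= k)%N -> z i = 0, `|f s - f x - j z| <= eps / 32
  & eps <= `|f s - f x|].
Proof.
(* If the first [k] coordinates are below [e], deleting them costs at most [e * C]. Requiring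
   [e * (1 + C) < eps / 32] leaves room for the approximation error [e / 2]. *)
pose C := \sum_(i < k) `|j (unit_vec i.+1)|.
have C0 : 0 <= C by apply: sumr_ge0.
have : 0 < eps / 32 / (1 + C) by rewrite !divr_gt0// ltr_pwDl.
move=> /ltr_add_invr[m]; rewrite add0r ltr_pdivlMr ?ltr_pwDl//.
have [rho rho0] := coord_finite m k.
set e := m.+1%:R^-1 => hrho eC.
have e0 : 0 < e by rewrite invr_gt0.
have [|s ] := osc (rho := Num.min rho k.+1%:R^-1).
  by rewrite lt_min rho0 invr_gt0 ltr0Sn.
rewrite lt_min => /andP[s1 s2] fs.
have [|y cy fy] := @j_dense (f s - f x) (e / 2); first by rewrite divr_gt0.
have ye := hrho s y s1 cy (ltW fy).
pose h := \sum_(i <- index_enum 'I_k) y i.+1 *: (unit_vec i.+1 : vec).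
have cu (i : 'I_k) : c00 (y i.+1 *: (unit_vec i.+1 : vec)).
  by apply: c00Z; exact: c00_unit.
have ch : c00 h by apply: c00_sum => i _; exact: cu.
have jh : `|j h| <= e * C.
  rewrite /h j_sum; last by move=> i _; exact: cu.
  apply: le_trans (ler_norm_sum _ _ _) _; rewrite mulr_sumr; apply: ler_sum => i _.
  rewrite j_scale; last exact: c00_unit.
  by rewrite normrZ ler_wpM2r// ltW// ye.
have hE i : (i < k)%N -> h i.+1 = y i.+1.
  move=> ik; rewrite /h fct_sumE (bigD1 (Ordinal ik))//= big1 ?addr0.
    by rewrite fctE /unit_vec eqxx [_ *: _]mulr1.
  move=> l; rewrite -val_eqE /= => li.
  by rewrite fctE /unit_vec eqSS (negbTE li) scaler0.
exists s, (y - h); split => //.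
- by rewrite -scaleN1r; apply: c00D => //; exact: c00Z.
- move=> [|i] ik; last by rewrite !fctE hE// subrr.
  by rewrite !fctE; case: cy ch => -> _ [-> _]; rewrite subr0.
- rewrite j_add//; last by rewrite -scaleN1r; exact: c00Z.
  rewrite -[- h]scaleN1r j_scale// scaleN1r opprD opprK addrA.
  apply: le_trans (ler_normD _ _) _.
  apply: le_trans (ltW eC); rewrite mulrDr mulr1.
  by rewrite lerD// (le_trans (ltW fy))// ler_pdivrMr//; lra.
Qed.

(** The tail vector has norm at least [eps - eps / 32], hence at least [eps / 2]; the quarter of it
    preserved by [W_chunk] is the [eps / 8] of a witness. *)
Lemma witness_dichotomy M k : (M <= k)%N ->
  witness eps [::] M x \/
  exists ks, [/\ pos_list ks, (weight a ks <= M)%N & witness eps ks k x].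
Proof.
move=> Mk; have [s [z [sx cz zk fz fs]]] := tail_difference k.
have zN : eps / 2 <= norm_iw a b z.
  rewrite -norm_j//.
  have : `|f s - f x| <= `|f s - f x - j z| + `|j z|.
    by rewrite -[X in `|X| <= _](subrK (j z)) ler_normD.
  by move: eps0; lra.
have N0 : 0 < norm_iw a b z by apply: lt_le_trans zN; rewrite divr_gt0.
have N34 : 3 / 4 * norm_iw a b z < norm_iw a b z by lra.
have [g Wg gz] := norm_iw_gt a_ge2 cz N34.
have [[c cc pc]|[ks [c [pks wM cc pc]]]] := W_chunk a_ge2 Mk Wg cz zk gz N0.
  left; exists s, z, c; split => //.
  - by apply: lt_le_trans sx _; rewrite lef_pV2 ?posrE ?ler_nat.
  - by split => // i iM; apply: zk; exact: leq_trans Mk.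
  - by rewrite weight0 invr1 mul1r (le_trans _ pc)//; lra.
right; exists ks; split => //; exists s, z, c; split => //.
by rewrite (le_trans _ pc)//; lra.
Qed.

Context (a_gt : forall k, (0 < k)%N -> (k < a k)%N).

(** Since [a k] exceeds [k], a bound on the weight bounds both the length and the entries of the
    list, which leaves finitely many lists. *)
Lemma weight_size ks : all (leq 1) ks ->
  (size ks < weight a ks)%N /\ (forall k, k \in ks -> (k < weight a ks)%N).
Proof.
elim: ks => [|k ks IH] /=; first by rewrite weight0.
move=> /andP[k0 /IH[h1 h2]].
have wE : weight a (k :: ks) = (a k * weight a ks)%N by rewrite /weight big_cons.
have ak := a_gt k0; have ak2 := a_ge2 k0.
rewrite wE; split; first by nia.
by move=> l; rewrite inE => /orP[/eqP->|/h2]; nia.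
Qed.

(* Pigeonhole: only finitely many lists have weight at most [M]. *)
Lemma bad_point_witness : exists2 ks, ks = [::] \/ pos_list ks &
  forall k, witness eps ks k x.
Proof.
have [h|/existsNP[M hM]] := pselect (forall k, witness eps [::] k x).
  by exists [::] => //; left.
have wit k : (M <= k)%N ->
    exists ks, [/\ pos_list ks, (weight a ks <= M)%N & witness eps ks k x].
  by move=> /witness_dichotomy[].
apply: contrapT => nex.
have /choice[kk hkk] : forall ks, exists k, pos_list ks -> ~ witness eps ks k x.
  move=> ks; apply: contrapT => nk; apply: nex; exists ks.
    right; apply: contrapT => np; apply: nk; by exists 0%N.
  by move=> k; apply: contrapT => nw; apply: nk; exists k.
(* Lists of length at most [M] with entries at most [M] form a finite type, so [K] lies beyond the
   failure index [kk] of every list of weight at most [M]. *)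
pose K := maxn M (\max_(c : {bseq M of 'I_M.+1}) kk (map val c)).
have [|ks [pks wM wK]] := wit K; first exact: leq_maxl.
apply: (hkk ks pks); apply: witness_le wK; rewrite /K leq_max; apply/orP; right.
have [_ pks2] := pks; have [sks mks] := weight_size pks2.
have sz : (size (map (@inord M) ks) <= M)%N.
  by rewrite size_map (leq_trans (ltnW sks)).
suff E : kk ks = kk (map val (Bseq sz)).
  by rewrite E; exact: (@leq_bigmax _ (fun c : {bseq M of 'I_M.+1} => kk (map val c))).
congr kk; rewrite /= -map_comp -[LHS]map_id; apply/eq_in_map => l lks /=.
by rewrite inordK// ltnS (leq_trans (ltnW (mks _ lks))).
Qed.

End BadPoint.

End LebesguePropertyXiw.

Theorem proposition4p6 (R : realType) (a b : nat -> nat)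
  (a_pos : forall k : nat, (0 < k)%N -> (0 < a k)%N)
  (a_incr : forall k : nat, (0 < k)%N -> (a k < a k.+1)%N)
  (a1 : a 1%N = 2%N)
  (b_pos : forall k : nat, (0 < k)%N -> (0 < b k)%N)
  (b_incr : forall k : nat, (0 < k)%N -> (b k < b k.+1)%N)
  (b1 : b 1%N = 1%N)
  (b_fast : forall k : nat, (0 < k)%N ->
     (b k)%:R * ln ((a k.+1)%:R ^+ 2) < (b k.+1)%:R :> R)
  (X : completeNormedModType R) (j : (nat -> R) -> X)
  (Xiw : is_X_iw a b j) :
  lebesgue_property X.
Proof.
have a_gt k : (0 < k)%N -> (k < a k)%N.
  case: k => // k _; elim: k => [|k IH]; first by rewrite a1.
  exact: leq_ltn_trans IH (a_incr _ _).
have a_ge2 k : (0 < k)%N -> (1 < a k)%N.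
  by move=> k0; exact: leq_ltn_trans k0 (a_gt _ k0).
move=> f If.
pose coordset (i : nat) (sg : bool) (n : nat) : set R :=
  [set x | [/\ 0 <= x <= 1, ~ range ratr x & forall rho : R, 0 < rho ->
      exists s y, [/\ `|s - x| < rho, c00 y, `|f s - f x - j y| <= n.+1%:R^-1 / 2
        & n.+1%:R^-1 <= (-1) ^+ sg * y i.+1]]].
pose witset (n : nat) (ks : seq nat) : set R :=
  [set x | [/\ 0 <= x <= 1, ~ range ratr x &
     (ks = [::] \/ pos_list ks) /\ forall k, witness a b j f n.+1%:R^-1 ks k x]].
have negQ : (@lebesgue_measure R).-negligible (\bigcup_(q : rat) [set ratr q]).
  apply: negligible_bigcup_count => q; apply/negligibleP; first exact: measurable_set1.
  exact: lebesgue_measure_set1.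
have negC : (@lebesgue_measure R).-negligible
    (\bigcup_(c : nat * bool * nat) coordset c.1.1 c.1.2 c.2).
  apply: negligible_bigcup_count => c.
  by apply: (negligible_coord a_ge2 Xiw _ If) => //; rewrite invr_gt0.
have negW : (@lebesgue_measure R).-negligible
    (\bigcup_(c : nat * seq nat) witset c.1 c.2).
  apply: negligible_bigcup_count => -[n ks] /=.
  have [pks|npks] := pselect (ks = [::] \/ pos_list ks).
    have n0 : 0 < n.+1%:R^-1 :> R by rewrite invr_gt0.
    apply: negligibleS (negligible_witness a_ge2 Xiw If a1 b1 n0 pks).
    by move=> x [? ? [_ ?]]; split.
  by apply: negligibleS (negligible_set0 _) => x [_ _ []].
(* Countably many negligible sets cover the discontinuities: a point outside the first two unions is
   irrational with continuous coordinates, and [bad_point_witness] puts it in the third. *)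
apply: negligibleS (negligibleU negQ (negligibleU negC negW)) => x /= /not_implyP[].
rewrite in_itv/= => x01 ncont; apply: contrapT => /not_orP[nQ /not_orP[nC nW]].
have xQ : ~ range ratr x by move=> [q _ qx]; apply: nQ; exists q.
have osc : exists n : nat, forall rho : R, 0 < rho ->
    exists2 s, `|s - x| < rho & n.+1%:R^-1 <= `|f s - f x|.
  apply: contrapT => nosc; apply: ncont.
  (* Without such an oscillation [f] would be continuous at [x] on the whole line, hence also within
     [0,1]. *)
  apply: cvg_within_filter; apply/cvgrPdist_lt => e e0.
  have [n ne] := ltr_add_invr e0; rewrite add0r in ne.
  apply: contrapT => nnear; apply: nosc; exists n => rho rho0.
  apply: contrapT => ns; apply: nnear.
  apply: filterS (nbhsx_ballx x rho rho0) => s; rewrite -ball_normE /= distrC => sx.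
  apply: lt_trans ne; rewrite ltNge distrC; apply/negP => hs; apply: ns.
  by exists s.
have [n hn] := osc.
have n0 : 0 < n.+1%:R^-1 :> R by rewrite invr_gt0.
have coord (m i : nat) : exists2 rho : R, 0 < rho &
    forall s y, `|s - x| < rho -> c00 y ->
      `|f s - f x - j y| <= m.+1%:R^-1 / 2 -> `|y i.+1| < m.+1%:R^-1.
  have hs (sg : bool) : exists2 rho : R, 0 < rho & forall s y, `|s - x| < rho -> c00 y ->
    `|f s - f x - j y| <= m.+1%:R^-1 / 2 -> (-1) ^+ sg * y i.+1 < m.+1%:R^-1.
    apply: contrapT => nrho; apply: nC; exists (i, sg, m) => //; split => //.
    move=> rho rho0; apply: contrapT => nsy; apply: nrho; exists rho => // s y sx cy fy.
    by rewrite ltNge; apply/negP => ny; apply: nsy; exists s, y.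
  (* The two signs together bound the absolute value of the coordinate. *)
  have [r1 r10 h1] := hs true; have [r2 r20 h2] := hs false.
  exists (Num.min r1 r2); first by rewrite lt_min r10.
  move=> s y; rewrite lt_min => /andP[s1 s2] cy fy.
  have := h1 s y s1 cy fy; have := h2 s y s2 cy fy.
  by rewrite expr0 mul1r expr1 mulN1r ltr_norml => -> u; rewrite andbT ltrNl.
have [ks pks wks] := bad_point_witness a_ge2 Xiw coord n0 hn a_gt.
by apply: nW; exists (n, ks).
Qed.
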